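(* Let $(X,d)$ be a metric space and let $\mathscr{B}$ be a bornology on $X$ with a closed base $\mathscr{S}$. Then the topology $\mathscr{T}_{\mathscr{B}}^s$ on $C(X)$ is metrizable if and only if the space $(C(X),\mathscr{T}_{\mathscr{B}}^s)$ has at least one $q_D$-point for some dense subset $D\subseteq C(X)$.
   Context: A bornology $\mathscr{B}$ on a nonempty set $X$ is a family of nonempty subsets of $X$ that covers $X$ and is closed under taking finite unions and under taking (nonempty) subsets. A subfamily $\mathscr{S}\subseteq\mathscr{B}$ is a base of $\mathscr{B}$ if each $B\in\mathscr{B}$ is contained in some $A\in\mathscr{S}$; it is a closed base if moreover every member of $\mathscr{S}$ is a closed subset of $X$. $C(X)$ is the set of continuous functions from $X$ to $\mathbb{R}$ (with the Euclidean metric). For $\delta>0$ and $B\subseteq X$, $B^\delta=\bigcup_{b\in B}\{x\in X: d(x,b)<\delta\}$. The topology $\mathscr{T}_{\mathscr{B}}^s$ of strong uniform convergence on $\mathscr{B}$ is the topology on $C(X)$ induced by the uniformity $\Delta_{\mathscr{B}}^s$ having as a base of entourages all sets $$[B;\varepsilon]^s=\{(f,g)\in C(X)\times C(X): \text{there is } \delta>0 \text{ such that } |f(x)-g(x)|<\varepsilon \text{ for all } x\in B^\delta\},$$ where $B\in\mathscr{B}$ and $\varepsilon>0$. Let $D$ be a dense subset of a topological space $T$. A point $x\in T$ is a $q_D$-point of $T$ if there is a sequence $\langle U_n:n\ge1\rangle$ of open neighborhoods of $x$ such that every sequence $\langle x_n:n\ge1\rangle$ with $x_n\in U_n\cap D$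 for all $n\ge1$ has a cluster point in $T$. In the claim, density of $D$ is with respect to $\mathscr{T}_{\mathscr{B}}^s$. *)

(* Defs.v *)
From HB Require Import structures.
From mathcomp Require Import all_boot all_order all_algebra.
From mathcomp Require Import all_classical all_reals all_analysis.

Set Implicit Arguments.
Unset Strict Implicit.
Unset Printing Implicit Defensive.

Import Order.TTheory GRing.Theory Num.Theory.
Import numFieldNormedType.Exports.
Local Open Scope classical_set_scope.
Local Open Scope ring_scope.

(* Members are nonempty, so only unions of finitely many, but at least one,
   members are meaningful; these reduce to binary unions. *)
Record bornology (X : Type) := Bornology {
  bornology_sets : set (set X) ;
  bornology_carrier_nonempty : [set: X] !=set0 ;
  bornology_nonempty : forall A, bornology_sets A -> A !=set0 ;
  bornology_cover : \bigcup_(A in bornology_sets) A = [set: X] ;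
  bornology_setU : forall A B,
    bornology_sets A -> bornology_sets B -> bornology_sets (A `|` B) ;
  bornology_subset : forall A B,
    bornology_sets B -> A `<=` B -> A !=set0 -> bornology_sets A
}.

Definition bornology_base (X : Type) (B : bornology X) (S : set (set X)) :=
  S `<=` bornology_sets B /\
  forall A, bornology_sets B A -> exists2 C, S C & A `<=` C.

Definition bornology_closed_base (X : topologicalType) (B : bornology X)
    (S : set (set X)) :=
  bornology_base B S /\ forall A, S A -> closed A.

Definition enlargement (R : realType) (X : metricType R) (A : set X) (delta : R)
    : set X :=
  \bigcup_(a in A) [set x | mdist x a < delta].

Definition strong_entourage (R : realType) (X : metricType R) (A : set X)
    (e : R) : set (continuousType X R * continuousType X R) :=
  [set fg : continuousType X R * continuousType X R |
    exists2 delta : R, 0 < delta &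
      forall x, enlargement A delta x -> `|fg.1 x - fg.2 x| < e].

(* [C(X)], tagged with a bornology so as to carry the uniformity of strong
   uniform convergence on it. *)
Definition strong_uniform (R : realType) (X : metricType R) (B : bornology X)
  : Type := continuousType X R.

Section StrongUniform.
Variables (R : realType) (X : metricType R) (B : bornology X).
Local Notation CX := (strong_uniform B).

Definition strong_uniform_ent : set_system (CX * CX) :=
  filter_from [set Ae : set X * R | bornology_sets B Ae.1 /\ 0 < Ae.2]
    (fun Ae => strong_entourage Ae.1 Ae.2).

Lemma enlargementS (A A' : set X) (d d' : R) :
  A `<=` A' -> d <= d' -> enlargement A d `<=` enlargement A' d'.
Proof.
move=> AA' dd' x [a Aa /= xa]; exists a; first exact: AA'.
exact: lt_le_trans xa dd'.
Qed.

Lemma strong_entourageS (A A' : set X) (e e' : R) :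
  A' `<=` A -> e <= e' -> strong_entourage A e `<=` strong_entourage A' e'.
Proof.
move=> AA' ee' fg [d d0 H]; exists d => // x xA.
by apply: lt_le_trans ee'; apply: H; exact: enlargementS xA.
Qed.

Lemma strong_uniform_ent_filter : Filter strong_uniform_ent.
Proof.
apply: filter_from_filter.
  have [x _] := bornology_carrier_nonempty B.
  have : (\bigcup_(A in bornology_sets B) A) x by rewrite bornology_cover.
  by case=> A BA _; exists (A, 1); split => /=.
move=> [A e] [A' e'] /= [BA e0] [BA' e'0].
exists (A `|` A', Num.min e e') => /=.
  by split; [exact: bornology_setU | rewrite lt_min e0].
move=> fg H; split; apply: strong_entourageS H.
- exact: subsetUl.
- by rewrite ge_min lexx.
- exact: subsetUr.
- by rewrite ge_min lexx orbT.
Qed.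

Local Open Scope relation_scope.

Lemma strong_uniform_ent_refl A : strong_uniform_ent A -> diagonal `<=` A.
Proof.
move=> [[C e] [/= _ e0] sA] [f g] /diagonalP <-; apply: sA.
by exists 1 => //= x _; rewrite subrr normr0.
Qed.

Lemma strong_uniform_ent_inv A : strong_uniform_ent A -> strong_uniform_ent A^-1.
Proof.
move=> [[C e] [/= BC e0] sA]; exists (C, e) => //= -[f g] [d d0 H].
by apply: sA; exists d => //= x /H /=; rewrite distrC.
Qed.

Lemma strong_uniform_ent_split A : strong_uniform_ent A ->
  exists2 C, strong_uniform_ent C & C \; C `<=` A.
Proof.
move=> [[C e] [/= BC e0] sA]; exists (strong_entourage C (e / 2)).
  by exists (C, e / 2) => //=; split => //; rewrite divr_gt0.
move=> [f g] [h [d d0 fh] [d' d'0 hg]]; apply: sA => /=.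
exists (Num.min d d') => /=; first by rewrite lt_min d0.
move=> x xC; rewrite (splitr e) -(subrKA (h x)).
rewrite (le_lt_trans (ler_normD _ _))// ltrD//.
- by apply: fh; apply: enlargementS xC => //; rewrite ge_min lexx.
- by apply: hg; apply: enlargementS xC => //; rewrite ge_min lexx orbT.
Qed.

Local Close Scope relation_scope.

HB.instance Definition _ := Choice.copy CX (continuousType X R).
HB.instance Definition _ := isUniform.Build CX strong_uniform_ent_filter
  strong_uniform_ent_refl strong_uniform_ent_inv strong_uniform_ent_split.

End StrongUniform.

Record is_metric (R : realType) (T : Type) (d : T -> T -> R) : Prop := IsMetric {
  is_metric_ge0 : forall x y, 0 <= d x y ;
  is_metric_eq0 : forall x y, d x y = 0 <-> x = y ;
  is_metric_sym : forall x y, d x y = d y x ;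
  is_metric_triangle : forall x y z, d x z <= d x y + d y z
}.

Definition metrizable (R : realType) (T : topologicalType) :=
  exists2 d : T -> T -> R, is_metric d &
    @nbhs T T = nbhs_ball_ (fun x e => [set y | d x y < e]).

(* Meant for a dense [D]. *)
Definition q_point (T : topologicalType) (D : set T) (x : T) :=
  exists2 U : nat -> set T, (forall n, open_nbhs x (U n)) &
    forall u : nat -> T, (forall n, (U n `&` D) (u n)) ->
      cluster (u @ \oo) !=set0.

(* Main.v *)
(** A cofinal increasing sequence [K] in the bornology makes the topology
    metrizable, with distance the infimum of the [e > 0] such that the functions
    are within [e] on an enlargement of each [K n] with [n.+1 * e < 1].  Such a
    sequence is extracted from a q_D-point [f]: the closed base yields closed
    increasing [K n] such that the [n]-th neighborhood of [f] contains every
    function agreeing with [f] near [K n].  If no [K n] contains [A], choose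
    [x n] in [A] outside [K n], add to [f] a bump of height [n] at [x n] that
    vanishes near [K n], and approximate the result in [D].  On the union of
    the [K n] a cluster point [h] stays within a bounded distance of [f], yet it
    follows infinitely many of the bumps.  Applying this first to constant
    sequences [x] shows that the [K n] cover the space. *)

Require Import Defs.
From mathcomp Require Import all_boot all_order all_algebra.
From mathcomp Require Import all_classical all_reals all_analysis.
From mathcomp Require Import lra.

Import Order.TTheory GRing.Theory Num.Theory.
Import numFieldNormedType.Exports.
Local Open Scope classical_set_scope.
Local Open Scope ring_scope.

(** * Bump functions off a closed set, and metrics from gauges *)

Lemma continuous_mdist (R : realType) (X : metricType R) (a : X) :
  continuous (fun y : X => mdist y a : R).
Proof.
move=> x; apply/cvgrPdist_lt => e e0; apply/metricType_numDomainType.nbhs_mdistP.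
exists e => //= y xy; rewrite (le_lt_trans _ xy)// ler_norml.
have := metric_triangle x y a; have := metric_triangle y x a.
by rewrite (metric_sym y x) => h1 h2; apply/andP; split; lra.
Qed.

(** If the [r]-ball at [x] misses [K], take the tent of radius [r / 2] at [x]. By the triangle
    inequality it vanishes on the whole [r / 2]-enlargement of [K], as strong convergence
    requires. *)
Lemma closed_bump {R : realType} {X : metricType R} {K : set X} {x : X} :
  closed K -> ~ K x ->
  exists2 phi : X -> R, continuous phi & phi x = 1 /\
    exists2 d : R, 0 < d & forall y, enlargement K d y -> phi y = 0.
Proof.
move=> Kcl Kx; have : nbhs x (~` K).
  by apply: open_nbhs_nbhs; split=> //; exact: closed_openC.
move=> /metricType_numDomainType.nbhs_mdistP[r /= r0 rK].
exists (fun y => Num.max 0 (1 - mdist y x / (r / 2))).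
  move=> y; apply: (@continuous_max R X (cst 0) (fun z => 1 - mdist z x / (r / 2))).
    exact: cvg_cst.
  apply: cvgB; first exact: cvg_cst.
  apply: cvgM; first exact: continuous_mdist.
  exact: cvg_cst.
split; first by rewrite mdistxx mul0r subr0; apply/max_idPr.
exists (r / 2); first by rewrite divr_gt0.
move=> y [b Kb /= yb]; apply/max_idPl.
rewrite subr_le0 ler_pdivlMr ?divr_gt0// mul1r.
have : r <= mdist x b by rewrite leNgt; apply/negP => /rK; exact.
have := metric_triangle x y b; rewrite (metric_sym x y); lra.
Qed.

Lemma homo_leq_subset {T : Type} {K : nat -> set T} :
  (forall n, K n `<=` K n.+1) -> forall {m n}, (m <= n)%N -> K m `<=` K n.
Proof.
move=> Kinc m n; elim: n => [|n IH]; first by rewrite leqn0 => /eqP ->.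
rewrite leq_eqVlt => /predU1P[-> //|/IH]; move/subset_trans; apply; exact: Kinc.
Qed.

(** Read [E e x y] as: the distance is at most about [e]. The metric is the infimum of such [e]; the
    additive triangle rule for [E] passes directly to it. *)
Lemma metrizable_gauge (R : realType) (T : topologicalType)
    (E : R -> T -> T -> Prop) :
  (forall x y, E 1 x y) ->
  (forall e x, 0 < e -> E e x x) ->
  (forall e x y, E e x y -> E e y x) ->
  (forall a b x y z, 0 < a -> 0 < b -> E a x y -> E b y z -> E (a + b) x z) ->
  (forall x y, (forall e, 0 < e -> E e x y) -> x = y) ->
  (forall x (V : set T),
     nbhs x V <-> exists2 e, 0 < e & forall y, E e x y -> V y) ->
  metrizable R T.
Proof.
move=> E1 Exx Esym Etri Esep Enbhs.
pose G x y := [set e : R | 0 < e /\ E e x y].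
have G0 x y : G x y !=set0 by exists 1; split.
have lbG x y : lbound (G x y) 0 by move=> e [/ltW].
have Ele a b x y : 0 < a -> a < b -> E a x y -> E b x y.
  move=> a0 ab Ea; rewrite -(subrKC a b).
  by apply: Etri Ea _ => //; rewrite ?subr_gt0//; apply: Exx; rewrite subr_gt0.
have infE e x y : inf (G x y) < e -> E e x y.
  by move=> /(inf_lt (G0 x y))[a [a0 Ea] ae]; exact: Ele Ea.
have leinf e x y : 0 < e -> E e x y -> inf (G x y) <= e.
  by move=> e0 Ee; apply: ge_inf; [exists 0; exact: lbG | split].
have inf_ge0 x y : 0 <= inf (G x y) by apply: lb_le_inf.
exists (fun x y => inf (G x y)).
  split => //.
  - move=> x y; split=> [xy|<-].
      by apply: Esep => e e0; apply: infE; rewrite xy.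
    apply/eqP; rewrite eq_le inf_ge0 andbT; apply/ler_addgt0Pl => e e0.
    by rewrite addr0 leinf//; exact: Exx.
  - move=> x y; congr inf; apply/seteqP.
    by split=> e [e0 /Esym Ee]; split.
  - move=> x y z; apply/ler_addgt0Pl => e e0.
    have e20 : 0 < e / 2 by rewrite divr_gt0.
    have xy0 : 0 < inf (G x y) + e / 2 by rewrite ltr_wpDl.
    have yz0 : 0 < inf (G y z) + e / 2 by rewrite ltr_wpDl.
    have : E ((inf (G x y) + e / 2) + (inf (G y z) + e / 2)) x z.
      by apply: (Etri _ _ _ y) => //; apply: infE; rewrite ltrDl.
    by move=> /leinf; rewrite addr_gt0// => /(_ isT); lra.
apply/funext => x; apply/seteqP; split=> V.
  by move=> /Enbhs[e e0 EV]; exists e => //= y /infE; exact: EV.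
(* Halving [e] is due to [E] bounding the infimum only non-strictly. *)
move=> [e /= e0 dV]; apply/Enbhs; exists (e / 2); first by rewrite divr_gt0.
move=> y /leinf; rewrite divr_gt0// => /(_ isT) xy; apply: dV => /=; lra.
Qed.

(** * Neighborhoods and metrizability of the strong uniform topology *)

Section StrongUniformTopology.
Context {R : realType} {X : metricType R} {B : bornology X}.
Implicit Types f g h : strong_uniform B.

Lemma nbhs_strongP f (V : set (strong_uniform B)) :
  nbhs f V <-> exists2 A : set X, bornology_sets B A & exists2 e : R, 0 < e &
    forall g, strong_entourage A e (f, g) -> V g.
Proof.
rewrite -nbhs_entourageE; split.
  move=> [E [[A e] /= [BA e0] AE] EV]; exists A => //; exists e => // g fg.
  exact/EV/xsectionP/AE.
move=> [A BA [e e0 AV]]; exists (strong_entourage A e).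
  by exists (A, e).
by move=> g /xsectionP; exact: AV.
Qed.

Lemma strong_entourage_sub {A : set X} {e : R} {f g} :
  strong_entourage A e (f, g) -> forall y, A y -> `|f y - g y| < e.
Proof.
by move=> [d d0 fg] y Ay; apply: fg; exists y => //=; rewrite mdistxx.
Qed.

Lemma bornology_set1 (x : X) : bornology_sets B [set x].
Proof.
have : (\bigcup_(A in bornology_sets B) A) x by rewrite bornology_cover.
move=> [A BA Ax]; apply: bornology_subset BA _ _; last by exists x.
by move=> _ ->.
Qed.

Lemma strong_metrizable (K : nat -> set X) :
  (forall n, bornology_sets B (K n)) ->
  (forall n, K n `<=` K n.+1) ->
  (forall A, bornology_sets B A -> exists n, A `<=` K n) ->
  metrizable R (strong_uniform B).
Proof.
move=> BK Kinc Kcof.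
(* Smaller [e] tests more of the [K n], and [e = 1] tests none. If [a + b] tests [K n], so do [a]
   and [b], whence the triangle rule. *)
pose E (e : R) f g :=
  forall n, n.+1%:R * e < 1 -> strong_entourage (K n) e (f, g).
have small (e : R) n : 0 < e -> exists2 a : R, 0 < a <= e & n.+1%:R * a < 1.
  move=> e0; exists (Num.min e (n.+2%:R^-1)).
    by rewrite lt_min e0 invr_gt0 ltr0n/= ge_min lexx.
  apply: (@le_lt_trans _ _ (n.+1%:R * n.+2%:R^-1)).
    by rewrite ler_pM2l// ge_min lexx orbT.
  by rewrite ltr_pdivrMr// mul1r ltr_nat.
apply: (@metrizable_gauge _ _ E).
- by move=> f g n; rewrite mulr1 ltrn1.
- by move=> e f e0 n _; exists 1 => // y _; rewrite subrr normr0.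
- move=> e f g fg n /fg[d d0 H]; exists d => // y /H /=.
  by rewrite distrC.
- move=> a b f g h a0 b0 fg gh n nab.
  have [|d d0 fgd] := fg n.
    by apply: le_lt_trans nab; rewrite ler_pM2l// lerDl ltW.
  have [|d' d'0 ghd] := gh n.
    by apply: le_lt_trans nab; rewrite ler_pM2l// lerDr ltW.
  exists (Num.min d d') => [|y yK] /=; first by rewrite lt_min d0.
  rewrite -(subrKA (g y)) (le_lt_trans (ler_normD _ _))// ltrD//.
  + by apply: fgd; apply: enlargementS yK => //; rewrite ge_min lexx.
  + by apply: ghd; apply: enlargementS yK => //; rewrite ge_min lexx orbT.
- move=> f g fg; apply/continuousEP => y.
  have [n yn] := Kcof _ (bornology_set1 y).
  apply/eqP; rewrite -subr_eq0 -normr_eq0 eq_le normr_ge0 andbT.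
  apply/ler_addgt0Pl => e e0; rewrite addr0.
  have [a /andP[a0 ae] na] := small e n e0.
  apply: le_trans ae; apply: ltW.
  by apply: (strong_entourage_sub (fg _ a0 _ na)); exact: yn.
- move=> f V; split=> [/nbhs_strongP[A BA [e e0 AV]]|[e e0 EV]].
    have [n An] := Kcof _ BA; have [a /andP[a0 ae] na] := small e n e0.
    by exists a => // g /(_ n na) fg; apply: AV; exact: strong_entourageS fg.
  (* Every [n] tested at [e] satisfies [n.+1 < e^-1], so this single [K] contains all the tested
     ones. *)
  apply/nbhs_strongP; exists (K (Num.truncn e^-1)) => //; exists e => // g fg.
  apply: EV => n ne; apply: strong_entourageS fg => //.
  apply: homo_leq_subset => //.
  have ei0 : 0 <= e^-1 by rewrite invr_ge0 ltW.
  rewrite -ltnS -(@ltr_nat R) (le_lt_trans _ (truncnS_gt _))//.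
  rewrite -[leRHS]mul1r ler_pdivlMr// ltW// (le_lt_trans _ ne)//.
  by rewrite ler_pM2r// ler_nat.
Qed.

(** Interiors of balls with radii tending to 0 force any chosen sequence to converge to [f], which
    is then a cluster point. *)
Lemma metrizable_q_point f :
  metrizable R (strong_uniform B) -> q_point [set: strong_uniform B] f.
Proof.
move=> [d dm nbhsE].
have nbhsd V : nbhs f V <-> exists2 e, 0 < e & [set g | d f g < e] `<=` V.
  by rewrite nbhsE.
exists (fun n => interior [set g | d f g < n.+1%:R^-1]).
  move=> n; split; first exact: open_interior.
  by apply/nbhsd; exists n.+1%:R^-1.
move=> u uU; exists f => V W [N _ NV] /nbhsd[e e0 eW].
have [m me] := ltr_add_invr e0; rewrite add0r in me.
exists (u (maxn N m)); split.
  by apply: NV; rewrite /= leq_maxl.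
have [/interior_subset/= um _] := uU (maxn N m).
apply: eW; apply: lt_trans um _; apply: le_lt_trans me.
by rewrite lef_pV2 ?posrE// ler_nat ltnS leq_maxr.
Qed.

(** * From a q_D-point to a cofinal sequence *)

Section QPoint.
Variables (D : set (strong_uniform B)) (f : strong_uniform B).
Variables (U : nat -> set (strong_uniform B)) (K : nat -> set X).
Hypothesis dense_D : dense D.
Hypothesis open_U : forall n, open (U n).
Hypothesis cluster_U : forall u : nat -> strong_uniform B,
  (forall n, (U n `&` D) (u n)) -> cluster (u @ \oo) !=set0.
Hypothesis closed_K : forall n, closed (K n).
Hypothesis K_inc : forall n, K n `<=` K n.+1.
Hypothesis U_agree : forall n g,
  (exists2 d : R, 0 < d & forall y, enlargement (K n) d y -> g y = f y) ->
  U n g.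

(** The 2 is the sum of two errors on [A], each below 1: from the bumped function to its approximant
    in [D], and from that to the cluster point [h]. *)
Lemma cluster_bump {A : set X} {x : nat -> X} : bornology_sets B A ->
  (forall n, A (x n)) -> (forall n, ~ K n (x n)) ->
  exists h, forall N, exists2 n, (N <= n)%N &
    (forall y, A y -> K n y -> `|f y - h y| < 2) /\
    `|f (x n) + n%:R - h (x n)| < 2.
Proof.
move=> BA Ax Kx.
have bump n : exists g, [/\ U n g, forall y, K n y -> g y = f y &
    g (x n) = f (x n) + n%:R].
  have [phi phic [phi1 [d d0 phi0]]] := closed_bump (closed_K n) (Kx n).
  have gc : continuous (fun y => f y + n%:R * phi y).
    move=> y; apply: cvgD; first exact: cts_fun.
    by apply: cvgM; [exact: cvg_cst | exact: phic].
  exists (mkcts gc : continuousType X R); split.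
  - by apply: U_agree; exists d => // y /phi0 phiy; rewrite /= /mkcts phiy mulr0 addr0.
  - move=> y Ky; rewrite /= /mkcts phi0 ?mulr0 ?addr0//.
    by exists y => //=; rewrite mdistxx.
  - by rewrite /= /mkcts phi1 mulr1.
have near_bump n : exists u, (U n `&` D) u /\ exists g, [/\
    forall y, K n y -> g y = f y, g (x n) = f (x n) + n%:R &
    forall y, A y -> `|g y - u y| < 1].
  have [g [Ug gK gx]] := bump n.
  pose V : set (strong_uniform B) := [set u | strong_entourage A 1 (g, u)].
  have gV : nbhs g V by apply/nbhs_strongP; exists A => //; exists 1.
  (* Density is applied to an open set around [g], so that the approximant also stays in [U n]. *)
  have [||u [[Uu /interior_subset Vu] Du]] := dense_D (U n `&` interior V).
  - by exists g.
  - by apply: openI; [exact: open_U | exact: open_interior].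
  exists u; split=> //; exists g; split=> //; exact: strong_entourage_sub Vu.
have [u uUD] := choice near_bump.
have [h hcl] := cluster_U u (fun n => (uUD n).1).
exists h => N.
(* Each tail of [u] meets each neighborhood of [h], which yields indices beyond any [N]. *)
have [||_ [[n /= Nn <-] hu]] := hcl (u @` [set n | (N <= n)%N])
    ([set v | strong_entourage A 1 (h, v)] : set (strong_uniform B)).
- by exists N => // n /= Nn; exists n.
- by apply/nbhs_strongP; exists A => //; exists 1.
exists n => //; have [_ [g [gK gx gu]]] := uUD n.
have gh y : A y -> `|g y - h y| < 2.
  move=> Ay; rewrite -(subrKA (u n y)) (le_lt_trans (ler_normD _ _))//.
  have := strong_entourage_sub hu y Ay; rewrite distrC.
  by have := gu y Ay; lra.
split=> [y Ay Ky|]; first by rewrite -gK//; exact: gh.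
by rewrite -gx; exact: gh.
Qed.

Lemma q_point_cover (x : X) : exists n, K n x.
Proof.
apply: contrapT => /forallNP Kx.
have [h hx] := cluster_bump (bornology_set1 x) (fun=> erefl) Kx.
(* The bump condition gives [n < |h x - f x| + 2], which is below the truncation plus 3. *)
have [n Nn [_]] := hx (Num.truncn `|h x - f x|).+3.
have := truncnS_gt `|h x - f x|; move: Nn; rewrite -(ler_nat R) -!natr1.
have := ler_norm (h x - f x).
by move=> ? ? ?; rewrite ltr_norml => /andP[? ?]; lra.
Qed.

Lemma q_point_cofinal (A : set X) : bornology_sets B A -> exists n, A `<=` K n.
Proof.
move=> BA; apply: contrapT => /forallNP AK.
have /choice[x xAK] n : exists x, A x /\ ~ K n x.
  by have /existsNP[x /not_implyP] := AK n; exists x.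
have [h hx] := cluster_bump BA (fun n => (xAK n).1) (fun n => (xAK n).2).
have fh y : A y -> `|f y - h y| < 2.
  (* Once [y] lies in [K m], it lies in [K n] for the later indices, where the bump vanishes; the
     bound 2 does not depend on [m]. *)
  move=> Ay; have [m Km] := q_point_cover y; have [n mn [H _]] := hx m.
  by apply: H => //; exact: (homo_leq_subset K_inc mn).
(* Two bounds by 2 at [x n] would give [n < 4]. *)
have [n Nn [_]] := hx 4%N; have := fh _ (xAK n).1.
move: Nn; rewrite -(ler_nat R) !ltr_norml => ? /andP[? ?] /andP[? ?]; lra.
Qed.

End QPoint.

Lemma q_point_metrizable {S : set (set X)} {D : set (strong_uniform B)} {f} :
  bornology_closed_base B S -> dense D -> q_point D f ->
  metrizable R (strong_uniform B).
Proof.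
move=> [[SB Sbase] Scl] dD [U openU clusterU].
(* Enlarge the set of a basic neighborhood inside [U n] to a closed base member: agreeing with [f]
   near it meets any tolerance [e]. *)
have /choice[C C_spec] n : exists C, [/\ bornology_sets B C, closed C &
    forall g, (exists2 d : R, 0 < d &
      forall y, enlargement C d y -> g y = f y) -> U n g].
  have /nbhs_strongP[A BA [e e0 AU]] := open_nbhs_nbhs (openU n).
  have [C SC AC] := Sbase _ BA.
  exists C; split; [exact: SB | exact: Scl |] => g [d d0 gf].
  apply: AU; exists d => // y yA /=.
  by rewrite gf ?subrr ?normr0//; exact: enlargementS yA.
(* Finite unions make the sequence increasing; they stay closed and in the bornology, though perhaps
   outside [S]. *)
pose K := fix K n := if n is m.+1 then K m `|` C m.+1 else C 0%N.
have K_inc n : K n `<=` K n.+1 by exact: subsetUl.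
have CK n : C n `<=` K n by case: n => // n; exact: subsetUr.
have BK n : bornology_sets B (K n).
  elim: n => [|n IH]; first by have [] := C_spec 0%N.
  by apply: bornology_setU => //; have [] := C_spec n.+1.
have Kcl n : closed (K n).
  elim: n => [|n IH]; first by have [] := C_spec 0%N.
  by apply: closedU => //; have [] := C_spec n.+1.
apply: (@strong_metrizable K) => //.
apply: (@q_point_cofinal D f U K) => // [n|n g [d d0 gf]].
  by have [] := openU n.
have [_ _] := C_spec n; apply; exists d => // y yC; apply: gf.
by apply: enlargementS yC.
Qed.

End StrongUniformTopology.

Theorem theorem3p3 (R : realType) (X : metricType R) (B : bornology X)
    (S : set (set X)) (hS : bornology_closed_base B S) :
  metrizable R (strong_uniform B) <->
  exists D : set (strong_uniform B),
    dense D /\ exists f : strong_uniform B, q_point D f.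
Proof.
split=> [met|[D [dD [f qf]]]]; last exact: q_point_metrizable hS dD qf.
exists setT; split; first by move=> O O0 _; rewrite setIT.
exists (cst 0 : continuousType X R); exact: metrizable_q_point.
Qed.
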